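(* Let $X$ be a completely regular topological space. Then $C_{\Lambda^{\downarrow}}(X,\mathbb{R})$ (with pointwise addition and scalar multiplication) is a topological vector space.
   Context: Let $\mathcal{O}_X$ be the set of open subsets of $X$. For a family $\mathcal{A}$ of subsets of $X$, $\mathcal{O}_X(\mathcal{A})$ is the family of open subsets of $X$ containing an element of $\mathcal{A}$. A compact family on $X$ is a nonempty $\mathcal{A}\subseteq\mathcal{O}_X$ with $\mathcal{O}_X(\mathcal{A})=\mathcal{A}$ such that whenever $\mathcal{P}\subseteq\mathcal{O}_X$ and $\bigcup\mathcal{P}\in\mathcal{A}$, there is a finite $\mathcal{P}_0\subseteq\mathcal{P}$ with $\bigcup\mathcal{P}_0\in\mathcal{A}$ (the family $\mathcal{O}_X$ itself is allowed). $\kappa(X)$ is the set of all compact families on $X$. A collection $\alpha\subseteq\kappa(X)$ is hereditarily self-joinable if for every $\mathcal{A}\in\alpha$ and every $A\in\mathcal{A}$ there is $\mathcal{G}\in\alpha$ with $A\in\mathcal{G}$ and $\mathcal{G}\vee\mathcal{G}\subseteq\mathcal{A}$, where $\mathcal{G}\vee\mathcal{G}=\{G_1\cap G_2:G_1,G_2\in\mathcal{G}\}$. $\Lambda^{\downarrow}(X)$ is the largest hereditarily self-joinable subset of $\kappa(X)$ (the union of all such collections, which is again hereditarily self-joinable). $C_{\Lambda^{\downarrow}}(X,\mathbb{R})$ is the set $C(X,\mathbb{R})$ of continuous functions $X\to\mathbb{R}$ with the topology having as subbase of open sets the sets $[\mathcal{A},U]=\{f: f^{-1}(U)\in\mathcal{A}\}$,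 for $\mathcal{A}\in\Lambda^{\downarrow}(X)$ and $U\subseteq\mathbb{R}$ open. *)

(* Defs.v *)
From HB Require Import structures.
From mathcomp Require Import all_boot all_order all_algebra.
From mathcomp Require Import boolp classical_sets functions cardinality.
From mathcomp Require Import reals topology normedtype.

Set Implicit Arguments.
Unset Strict Implicit.
Unset Printing Implicit Defensive.

Import GRing.Theory.
Import numFieldNormedType.Exports.

Local Open Scope classical_set_scope.
Local Open Scope ring_scope.

Section compact_families.
Variable X : topologicalType.
Implicit Types A G H : set (set X).

Definition open_supersets A : set (set X) :=
  [set O | open O /\ exists2 S, A S & S `<=` O].

Definition compact_family A : Prop :=
  [/\ A !=set0, A `<=` open, open_supersets A = A &
      forall P : set (set X), P `<=` open -> A (\bigcup_(O in P) O) ->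
        exists P0 : set (set X),
          [/\ P0 `<=` P, finite_set P0 & A (\bigcup_(O in P0) O)]].

Definition kappa : set (set (set X)) := [set A | compact_family A].

Definition family_join G H : set (set X) :=
  [set G1 `&` G2 | G1 in G & G2 in H].

Definition hereditarily_self_joinable (alpha : set (set (set X))) : Prop :=
  alpha `<=` kappa /\
  forall A, alpha A -> forall O, A O ->
    exists G, [/\ alpha G, G O & family_join G G `<=` A].

Definition Lambda_down : set (set (set X)) :=
  \bigcup_(alpha in hereditarily_self_joinable) alpha.

Lemma Lambda_down_hereditarily_self_joinable :
  hereditarily_self_joinable Lambda_down.
Proof.
split=> [A [alpha [sub_kappa _] /sub_kappa]//|A [alpha hsj alphaA] O AO].
have [G [alphaG GO GGA]] := hsj.2 A alphaA O AO.
by exists G; split=> //; exists alpha.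
Qed.

Lemma Lambda_down_largest (alpha : set (set (set X))) :
  hereditarily_self_joinable alpha -> alpha `<=` Lambda_down.
Proof. by move=> hsj A alphaA; exists alpha. Qed.

End compact_families.

(* An alias of the type of continuous functions, so that the topology below does
   not compete with the pointwise, uniform and compact-open ones. *)
Definition CLambda (X : topologicalType) (R : realType) : Type :=
  continuousType X R.

Section CLambda_lmodule.
Variables (X : topologicalType) (R : realType).

HB.instance Definition _ := Choice.copy (CLambda X R) (continuousType X R).

Implicit Types f g h : CLambda X R.

Definition CLambda_fun f : X -> R := Continuous.sort f.

Lemma CLambda_eqP f g : (forall x, CLambda_fun f x = CLambda_fun g x) -> f = g.
Proof. by move=> fg; apply/continuousEP => x; exact: fg. Qed.

Let zero_continuous : continuous (fun _ : X => 0 : R).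
Proof. by move=> x; exact: cvg_cst. Qed.

Let opp_continuous f : continuous (fun x => - CLambda_fun f x).
Proof. by move=> x; apply: cvgN; exact: cts_fun. Qed.

Let add_continuous f g :
  continuous (fun x => CLambda_fun f x + CLambda_fun g x).
Proof. by move=> x; apply: cvgD; exact: cts_fun. Qed.

Let scale_continuous (c : R) f : continuous (fun x => c * CLambda_fun f x).
Proof. by move=> x; apply: cvgM; [exact: cvg_cst|exact: cts_fun]. Qed.

Definition CLambda_zero : CLambda X R := mkcts zero_continuous.
Definition CLambda_opp f : CLambda X R := mkcts (@opp_continuous f).
Definition CLambda_add f g : CLambda X R := mkcts (@add_continuous f g).
Definition CLambda_scale c f : CLambda X R := mkcts (@scale_continuous c f).

Let addA : associative CLambda_add.
Proof. by move=> f g h; apply: CLambda_eqP => x; exact: addrA. Qed.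

Let addC : commutative CLambda_add.
Proof. by move=> f g; apply: CLambda_eqP => x; exact: addrC. Qed.

Let add0 : left_id CLambda_zero CLambda_add.
Proof. by move=> f; apply: CLambda_eqP => x; exact: add0r. Qed.

Let addN : left_inverse CLambda_zero CLambda_opp CLambda_add.
Proof. by move=> f; apply: CLambda_eqP => x; exact: addNr. Qed.

HB.instance Definition _ :=
  GRing.isZmodule.Build (CLambda X R) addA addC add0 addN.

Let scaleA (a b : R) f :
  CLambda_scale a (CLambda_scale b f) = CLambda_scale (a * b) f.
Proof. by apply: CLambda_eqP => x; exact: mulrA. Qed.

Let scale1 : left_id 1 CLambda_scale.
Proof. by move=> f; apply: CLambda_eqP => x; exact: mul1r. Qed.

Let scaleDr : right_distributive CLambda_scale +%R.
Proof. by move=> c f g; apply: CLambda_eqP => x; exact: mulrDr. Qed.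

Let scaleDl f : {morph CLambda_scale^~ f : a b / a + b}.
Proof. by move=> a b; apply: CLambda_eqP => x; exact: mulrDl. Qed.

HB.instance Definition _ :=
  GRing.Zmodule_isLmodule.Build R (CLambda X R) scaleA scale1 scaleDr scaleDl.

End CLambda_lmodule.

Section CLambda_topology.
Variables (X : topologicalType) (R : realType).

Definition CLambda_subbasic (A : set (set X)) (U : set R) :
    set (CLambda X R) :=
  [set f | A (CLambda_fun f @^-1` U)].

Definition CLambda_subbase : set (set (CLambda X R)) :=
  [set CLambda_subbasic A U | A in @Lambda_down X & U in @open R].

HB.instance Definition _ :=
  isSubBaseTopological.Build (CLambda X R) CLambda_subbase id.

End CLambda_topology.

(* preTopologicalLmodType imposes no compatibility between the topology and the
   operations; the equation forces W to carry exactly those of V. *)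
Definition is_topological_vector_space (K : numDomainType)
    (V : preTopologicalLmodType K) : Prop :=
  exists W : topologicalLmodType K, W = V :> preTopologicalLmodType K.

Lemma is_topological_vector_spaceP (K : numDomainType)
    (V : preTopologicalLmodType K) :
  is_topological_vector_space V <->
  continuous (fun z : V * V => z.1 + z.2) /\
  continuous (fun z : K^o * V => z.1 *: z.2).
Proof.
split=> [[W <-]|].
  by split; [exact: add_continuous|exact: scale_continuous].
case: V => T c [addV scaleV].
pose V := PreTopologicalLmodule.Pack c.
pose addM := PreTopologicalNmodule_isTopologicalNmodule.Build V addV.
pose scaleM := TopologicalNmodule_isTopologicalLmodule.Build K V scaleV.
by exists (HB.pack_for (topologicalLmodType K) V addM scaleM).
Qed.

(* Main.v *)
Require Import Defs.
From mathcomp Require Import all_boot all_order all_algebra.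
From mathcomp Require Import boolp classical_sets functions cardinality.
From mathcomp Require Import reals topology normedtype.

(** Write Lambda for the largest hereditarily self-joinable collection of
    compact families.  The proof rests on two closure properties of Lambda.

    Joins: a member O of A in Lambda lies in some G in Lambda whose pairwise
    intersections belong to A; hence finitely many conditions, each of which
    can be achieved on a member of every family of Lambda, can be achieved
    simultaneously on a member of A ([nearly_everywhereI],
    [nearly_everywhere_finite]).

    Sections: if G is in Lambda and V is open, then the open sets whose union
    with V belongs to G form again a family of Lambda ([Lambda_down_section]).
    This localizes the subbasic neighborhoods: given f and a neighborhood N of
    f x, pick open sets J, I with f x in J and the closure of J in I, I in N.
    With V the preimage under f of the complement of the closure of J, the
    preimage of I under f belongs to the section by V since its union with V is
    the whole space.  Any g close to f has the same property, so that on a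
    member of G, f y in J implies g y in N ([CLambda_nearly_everywhere]).

    Let now z0 be given and let h be the sum or the scalar product, with the
    preimage of the open set U under h z0 in A.  Each point of that preimage
    has, by continuity of the operation of the reals and localization, an open
    neighborhood W such that, given a family of Lambda, for all z near z0, h z
    maps into U those points of some member of the family that lie in W.
    As A is compact, finitely many of these neighborhoods have their union in
    A, and the join property combines the corresponding finitely many
    conditions with that union ([CLambda_continuous_at]). *)

Import GRing.Theory.
Import numFieldNormedType.Exports.

Local Open Scope classical_set_scope.
Local Open Scope ring_scope.

Section compact_families.
Context {X : topologicalType}.
Implicit Types (A G : set (set X)) (O V : set X).

Lemma kappa_up A O V : kappa A -> A O -> open V -> O `<=` V -> A V.
Proof.
by move=> kA AO oV OV; have [_ _ <- _] := kA; split=> //; exists O.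
Qed.

Lemma kappaT A : kappa A -> A setT.
Proof. by move=> kA; have [[O AO] _ _ _] := kA; apply: kappa_up AO openT _. Qed.

(** The section of the family G by the closed complement of V: the open sets
    that become members of G once V is added to them. *)
Definition family_section G V : set (set X) := [set O | open O /\ G (O `|` V)].

Lemma kappa_section G V : open V -> kappa G -> kappa (family_section G V).
Proof.
move=> oV kG; split.
- exists setT; split; first exact: openT.
  by rewrite setTU; exact: kappaT.
- by move=> O [].
- apply/seteqP; split=> [O [oO [S [_ GS] SO]]|O [oO GO]].
    by split=> //; apply: kappa_up GS _ _ => //; [exact: openU|exact: setSU].
  by split=> //; exists O.
- move=> P Popen [_ GP]; have [_ _ _ cG] := kG.
  (* Adding V as a member of the cover accounts for the case of an empty P. *)
  have oPV : [set O `|` V | O in P] `|` [set V] `<=` open.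
    by move=> _ [[O PO <-]|->] //; apply: openU => //; exact: Popen.
  have [|Q [QP finQ GQ]] := cG _ oPV.
    apply: (kappa_up _ _ _ kG GP); first exact: bigcup_open.
    move=> x [[O PO Ox]|Vx]; last by exists V => //; right.
    by exists (O `|` V); [left; exists O|left].
  (* f W is an element of P whose union with V is W, for W in Q except V. *)
  have [f fP] : exists f : set X -> set X, forall W, Q W -> W <> V ->
      P (f W) /\ f W `|` V = W.
    suff /choice[f fP] : forall W, exists O, Q W -> W <> V ->
        P O /\ O `|` V = W by exists f.
    move=> W; have [[QW WV]|nW] := pselect (Q W /\ W <> V); last first.
      by exists set0 => QW WV; case: nW.
    by case: (QP _ QW) => [[O PO OW]|//]; exists O.
  exists (f @` (Q `&` [set W | W <> V])); split.
  + by move=> _ [W [QW /= WV] <-]; case: (fP _ QW WV).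
  + exact/finite_image/finite_setIl.
  + have oU : open (\bigcup_(O in f @` (Q `&` [set W | W <> V])) O).
      apply: bigcup_open => _ [W [QW /= WV] <-].
      by apply: Popen; case: (fP _ QW WV).
    split=> //; apply: (kappa_up _ _ _ kG GQ); first exact: openU.
    move=> x [W QW Wx]; have [WE|WV] := pselect (W = V).
      by right; rewrite -WE.
    have [_ fWV] := fP _ QW WV; rewrite -fWV in Wx.
    by case: Wx => [fWx|]; [left; exists (f W) => //; exists W|right].
Qed.

Lemma Lambda_down_kappa A : Lambda_down A -> kappa A.
Proof. exact: (Lambda_down_hereditarily_self_joinable X).1. Qed.

Lemma Lambda_down_join A O : Lambda_down A -> A O ->
  exists G, [/\ Lambda_down G, G O &
    forall O1 O2, G O1 -> G O2 -> A (O1 `&` O2)].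
Proof.
move=> LA AO.
have [G [LG GO GA]] := (Lambda_down_hereditarily_self_joinable X).2 A LA O AO.
by exists G; split=> // O1 O2 G1 G2; apply: GA; exists O1 => //; exists O2.
Qed.

(** Union with V distributes over intersections, so sectioning preserves
    hereditary self-joinability. *)
Lemma Lambda_down_section G V :
  open V -> Lambda_down G -> Lambda_down (family_section G V).
Proof.
move=> oV LG.
apply: (@Lambda_down_largest _ (family_section ^~ V @` @Lambda_down X)).
  split=> [_ [A LA <-]|_ [A LA <-] O [oO AO]].
    by apply: kappa_section => //; exact: Lambda_down_kappa.
  have [H [LH HO HA]] := Lambda_down_join _ _ LA AO.
  exists (family_section H V); split=> //; first by exists H.
  move=> _ [O1 [oO1 HO1] [O2 [oO2 HO2] <-]]; split; first exact: openI.
  by rewrite setUIl; exact: HA.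
by exists G.
Qed.

End compact_families.

Section nearly_everywhere.
Context {X : topologicalType} {Y : Type}.

(** Along the filter F, the condition Q y x holds at all points x of some
    member of A, for each A in the largest hereditarily self-joinable
    collection. *)
Definition nearly_everywhere (F : set_system Y) (Q : Y -> X -> Prop) :=
  forall A : set (set X), Lambda_down A ->
    \forall y \near F, exists2 O, A O & forall x, O x -> Q y x.

Context {F : set_system Y} {FF : Filter F}.
Implicit Types Q : Y -> X -> Prop.

Lemma nearly_everywhere_near (P : Y -> Prop) :
  (\forall y \near F, P y) -> nearly_everywhere F (fun y _ => P y).
Proof.
move=> FP A LA; apply: filterS FP => y Py.
by exists setT => //; exact: kappaT _ (Lambda_down_kappa _ LA).
Qed.

Lemma nearly_everywhereS Q1 Q2 : (forall y x, Q1 y x -> Q2 y x) ->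
  nearly_everywhere F Q1 -> nearly_everywhere F Q2.
Proof.
move=> Q12 FQ A LA; apply: filterS (FQ A LA) => y [O AO OQ].
by exists O => // x /OQ /Q12.
Qed.

Lemma nearly_everywhereI Q1 Q2 :
  nearly_everywhere F Q1 -> nearly_everywhere F Q2 ->
  nearly_everywhere F (fun y x => Q1 y x /\ Q2 y x).
Proof.
move=> FQ1 FQ2 A LA.
have [G [LG _ GA]] :=
  Lambda_down_join _ _ LA (kappaT _ (Lambda_down_kappa _ LA)).
apply: filterS2 (FQ1 G LG) (FQ2 G LG) => y [O1 GO1 O1Q] [O2 GO2 O2Q].
by exists (O1 `&` O2); [exact: GA|move=> x [/O1Q ? /O2Q]].
Qed.

Lemma nearly_everywhere_finite (I : eqType) (P : set I)
    (Q : I -> Y -> X -> Prop) :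
  finite_set P -> (forall i, P i -> nearly_everywhere F (Q i)) ->
  nearly_everywhere F (fun y x => forall i, P i -> Q i y x).
Proof.
move=> /finite_seqP[s ->]; elim: s => [_|i s IH FQ].
  by apply: nearly_everywhereS (nearly_everywhere_near _ filterT).
have FQi : nearly_everywhere F (Q i) by apply: FQ; rewrite /= mem_head.
have FQs : nearly_everywhere F (fun y x => forall j, [set` s] j -> Q j y x).
  by apply: IH => j js; apply: FQ; rewrite /= inE; apply/orP; right.
apply: nearly_everywhereS (nearly_everywhereI _ _ FQi FQs).
move=> y x [Qi Qs] j; rewrite /= inE => /orP[/eqP ->//|js]; exact: Qs.
Qed.

End nearly_everywhere.

Lemma nearly_everywhere_comp (X : topologicalType) (Y Z : Type)
    (F : set_system Y) (G : set_system Z) (h : Y -> Z) (Q : Z -> X -> Prop) :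
  h @ F --> G -> nearly_everywhere G Q ->
  nearly_everywhere F (fun y => Q (h y)).
Proof. by move=> hFG GQ A LA; exact: hFG (GQ A LA). Qed.

Section CLambda_neighborhoods.
Context {R : realType} {X : topologicalType}.
Local Notation C := (CLambda X R).

Lemma CLambda_fun_continuous (f : C) : continuous (CLambda_fun f).
Proof. exact: cts_fun. Qed.

Lemma CLambda_preimage_open (f : C) (U : set R) :
  open U -> open (CLambda_fun f @^-1` U).
Proof. by move: U; apply/continuousP; exact: CLambda_fun_continuous. Qed.

(** Convergence needs to be tested on the subbase only. *)
Lemma CLambda_cvg (F : set_system C) (f : C) : Filter F ->
  (forall A U, Lambda_down A -> open U -> A (CLambda_fun f @^-1` U) ->
    \forall g \near F, A (CLambda_fun g @^-1` U)) ->
  F --> f.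
Proof.
move=> FF FA N; rewrite nbhsE => -[B [[D DI <-] [W DW Wf]] BN].
have [E ED EW] := DI _ DW.
have : F W.
  rewrite -EW; apply: filter_bigI => S ES.
  have /set_mem [A LA [U oU SE]] := ED _ ES.
  rewrite -SE; apply: FA => //.
  by move: Wf; rewrite -EW => /(_ _ ES); rewrite -SE.
by apply: filterS => g Wg; apply: BN; exists W.
Qed.

Lemma CLambda_nbhs_subbasic (f : C) (A : set (set X)) (U : set R) :
  Lambda_down A -> open U -> A (CLambda_fun f @^-1` U) ->
  nbhs f (CLambda_subbasic A U).
Proof.
move=> LA oU AfU; rewrite nbhsE /=.
exists (CLambda_subbasic A U) => //; split=> //.
exists [set CLambda_subbasic A U]; last by rewrite bigcup_set1.
by move=> _ ->; apply: finI_from1; exists A => //; exists U.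
Qed.

(** Around x, on a member of any prescribed family, the values of a function g
    close to f stay in the neighborhood N of f x. *)
Lemma CLambda_nearly_everywhere (f : C) (x : X) (N : set R) :
  nbhs (CLambda_fun f x) N ->
  exists2 V : set X, open V /\ V x &
    nearly_everywhere (nbhs f) (fun g y => V y -> N (CLambda_fun g y)).
Proof.
rewrite nbhsE => -[I [oI Ifx] IN].
have [J0 + clJI] := uniform_regular (open_nbhs_nbhs (conj oI Ifx)).
rewrite nbhsE => -[J [oJ Jfx] JJ0].
exists (CLambda_fun f @^-1` J).
  by split=> //; exact: CLambda_preimage_open.
move=> A LA; set V := CLambda_fun f @^-1` (~` closure J).
have oV : open V.
  by apply: CLambda_preimage_open; apply: closed_openC; exact: closed_closure.
have LAV := Lambda_down_section _ _ oV LA.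
have AVf : family_section A V (CLambda_fun f @^-1` I).
  split; first exact: CLambda_preimage_open.
  rewrite (_ : _ `|` _ = setT); first exact: kappaT _ (Lambda_down_kappa _ LA).
  apply/seteqP; split=> // y _.
  have [Jy|] := pselect (closure J (CLambda_fun f y)); last by right.
  by left; apply: clJI; exact: closureS Jy.
apply: filterS (CLambda_nbhs_subbasic _ _ _ LAV oI AVf) => g [_ AgV].
exists (CLambda_fun g @^-1` I `|` V) => // y [Igy _|nJ Jfy]; first exact: IN.
by case: nJ; exact: subset_closure.
Qed.

(** Local to global: it suffices to control h y near each point of the
    preimage of U, thanks to the compactness of the families. *)
Lemma CLambda_continuous_at (Y : topologicalType) (h : Y -> C) (y0 : Y) :
  (forall (U : set R) x, open U -> U (CLambda_fun (h y0) x) ->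
    exists2 V : set X, open V /\ V x &
      nearly_everywhere (nbhs y0)
        (fun y z => V z -> U (CLambda_fun (h y) z))) ->
  {for y0, continuous h}.
Proof.
move=> hloc; apply: CLambda_cvg => A U LA oU AhU.
pose Q (V : set X) y z := V z -> U (CLambda_fun (h y) z).
pose P : set (set X) := [set V | open V /\ nearly_everywhere (nbhs y0) (Q V)].
have kA := Lambda_down_kappa _ LA.
have Popen : P `<=` open by move=> V [].
have AP : A (\bigcup_(V in P) V).
  apply: (kappa_up _ _ _ kA AhU); first exact: bigcup_open.
  by move=> x /(hloc U x oU) [V [oV Vx] hV]; exists V.
have [_ _ _ /(_ P Popen AP) [P0 [P0P finP0 AP0]]] := kA.
have [G [LG GP0 GA]] := Lambda_down_join _ _ LA AP0.
have FQ : nearly_everywhere (nbhs y0) (fun y z => forall V, P0 V -> Q V y z).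
  by apply: nearly_everywhere_finite => // V /P0P [].
rewrite near_simpl; apply: filterS (FQ G LG) => y [O GO OQ].
apply: (kappa_up _ _ _ kA (GA _ _ GO GP0)); first exact: CLambda_preimage_open.
by move=> z [Oz [V P0V Vz]]; exact: OQ P0V Vz.
Qed.

End CLambda_neighborhoods.

Lemma CLambda_add_continuous (R : realType) (X : topologicalType) :
  continuous (fun z : CLambda X R * CLambda X R => z.1 + z.2).
Proof.
move=> [f g]; apply: CLambda_continuous_at => U x oU Ux.
have := @add_continuous R^o (CLambda_fun f x, CLambda_fun g x) U
  (open_nbhs_nbhs (conj oU Ux)).
case=> -[/= I J] [/= nI nJ] IJU.
have [V [oV Vx] nV] := CLambda_nearly_everywhere _ _ _ nI.
have [W [oW Wx] nW] := CLambda_nearly_everywhere _ _ _ nJ.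
exists (V `&` W); first by split=> //; exact: openI.
apply: nearly_everywhereS (nearly_everywhereI _ _
  (nearly_everywhere_comp _ _ _ _ _ _ _ cvg_fst nV)
  (nearly_everywhere_comp _ _ _ _ _ _ _ cvg_snd nW)) => -[f' g'] z /=.
by move=> [If' Jg'] [/If' If'z /Jg' Jg'z]; exact: (IJU (_, _)).
Qed.

Lemma CLambda_scale_continuous (R : realType) (X : topologicalType) :
  continuous (fun z : R^o * CLambda X R => z.1 *: z.2).
Proof.
move=> [c f]; apply: CLambda_continuous_at => U x oU Ux.
have := @mul_continuous R (c, CLambda_fun f x) U (open_nbhs_nbhs (conj oU Ux)).
case=> -[/= I J] [/= nI nJ] IJU.
have [V oVx nV] := CLambda_nearly_everywhere _ _ _ nJ.
exists V => //.
apply: nearly_everywhereS (nearly_everywhereI _ _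
  (nearly_everywhere_comp _ _ _ _ _ _ _ cvg_fst (nearly_everywhere_near _ nI))
  (nearly_everywhere_comp _ _ _ _ _ _ _ cvg_snd nV)) => -[c' f'] z /=.
by move=> [Ic' Jf'] /Jf' Jf'z; exact: (IJU (_, _)).
Qed.

Theorem corollary4p5 (R : realType) (X : topologicalType)
    (hX : completely_regular_space X) :
  is_topological_vector_space (CLambda X R : preTopologicalLmodType R).
Proof.
apply/is_topological_vector_spaceP; split.
  exact: CLambda_add_continuous.
exact: CLambda_scale_continuous.
Qed.
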